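(* Let $L\subseteq\{0,1\}^*$ be an undecidable binary language, and let $\mathcal{F}_L=\{G_w : w\in L\}$, where the graphs $G_w$ are as defined in the context. Then the full $\mathcal{F}_L$-colouring problem (given a graph $G$, decide whether $G$ admits a full homomorphism to some graph in $\mathcal{F}_L$) is undecidable.
   Context: Graphs are finite and undirected, with neither loops nor parallel edges. A full homomorphism from $G$ to $H$ is a function $\varphi\colon V_G\to V_H$ such that, for all $u,v\in V_G$, $uv\in E_G$ if and only if $\varphi(u)\varphi(v)\in E_H$. $C_n$ is the cycle on $n$ vertices, $\overline{G}$ is the complement of $G$, and $+$ and $\sum$ denote disjoint union of graphs. The double ended $n$-pan is the graph obtained from two disjoint copies of $C_n$ by adding one edge (a bridge) joining a vertex of one copy to a vertex of the other. For a word $w\in\{0,1\}^*$, let $\ell(w)$ be its length, $S_w$ the set of positions of $w$ which are $0$, and $T_w$ the set of positions of $w$ which are $1$ (positions are numbered $1,\dots,\ell(w)$). The graph $G_w$ is the disjoint union of the double ended $(\ell(w)+6)$-pan and the graph $\sum_{n\in S_w}C_{n+6}+\sum_{n\in T_w}\overline{C_{n+6}}$. *)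

(* Defs.v *)
From mathcomp Require Import all_boot.

Set Implicit Arguments.
Unset Strict Implicit.
Unset Printing Implicit Defensive.

(** * Graphs *)

Record sgraph := SGraph {
  vertex :> finType;
  edge : rel vertex;
  edge_sym : symmetric edge;
  edge_irrefl : irreflexive edge }.

Definition full_hom (G H : sgraph) (phi : G -> H) : Prop :=
  forall u v : G, edge u v <-> edge (phi u) (phi v).

Definition full_colourable (F : sgraph -> Prop) (G : sgraph) : Prop :=
  exists2 H : sgraph, F H & exists phi : G -> H, full_hom phi.

Section Complement.
Variable G : sgraph.

Definition compl_edge : rel G := fun u v => (u != v) && ~~ edge u v.

Lemma compl_edge_sym : symmetric compl_edge.
Proof. by move=> u v; rewrite /compl_edge eq_sym edge_sym. Qed.

Lemma compl_edge_irrefl : irreflexive compl_edge.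
Proof. by move=> u; rewrite /compl_edge eqxx. Qed.

Definition compl : sgraph := SGraph compl_edge_sym compl_edge_irrefl.
End Complement.

Section DisjointUnion.
Variables G H : sgraph.

Definition dunion_edge : rel (G + H) := fun u v =>
  match u, v with
  | inl x, inl y => edge x y
  | inr x, inr y => edge x y
  | _, _ => false
  end.

Lemma dunion_edge_sym : symmetric dunion_edge.
Proof. by move=> [x|x] [y|y] //=; exact: edge_sym. Qed.

Lemma dunion_edge_irrefl : irreflexive dunion_edge.
Proof. by move=> [x|x] /=; exact: edge_irrefl. Qed.

Definition dunion : sgraph := SGraph dunion_edge_sym dunion_edge_irrefl.
End DisjointUnion.

Section DisjointSum.
Variables (I : finType) (G : I -> sgraph).

(* [tagged_as u v] is the vertex of [v] seen in the summand of [u], which is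
   meaningful because the two tags agree. *)
Definition dsum_edge : rel {i : I & G i} := fun u v =>
  (tag u == tag v) && edge (tagged u) (tagged_as u v).

Lemma dsum_edge_sym : symmetric dsum_edge.
Proof.
move=> [i x] [j y]; rewrite /dsum_edge /= eq_sym.
have [eq_ij | //] := eqVneq j i; case: i / eq_ij x => x.
by rewrite !tagged_asE edge_sym.
Qed.

Lemma dsum_edge_irrefl : irreflexive dsum_edge.
Proof. by move=> [i x]; rewrite /dsum_edge /= eqxx tagged_asE edge_irrefl. Qed.

Definition dsum : sgraph := SGraph dsum_edge_sym dsum_edge_irrefl.
End DisjointSum.

Section Cycle.
Variable n : nat.

(* [ordS] is the successor modulo [n].  The conjunct [i != j] only matters for
   [n = 1]; the definition is the usual cycle for [2 < n]. *)
Definition cycle_edge : rel 'I_n := fun i j =>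
  (i != j) && ((ordS i == j) || (ordS j == i)).

Lemma cycle_edge_sym : symmetric cycle_edge.
Proof. by move=> i j; rewrite /cycle_edge eq_sym orbC. Qed.

Lemma cycle_edge_irrefl : irreflexive cycle_edge.
Proof. by move=> i; rewrite /cycle_edge eqxx. Qed.

Definition cycle_graph : sgraph := SGraph cycle_edge_sym cycle_edge_irrefl.
End Cycle.

Section DoubleEndedPan.
Variable n : nat.

(* The bridge joins the vertices numbered 0 of the two copies. *)
Definition pan_bridge : rel (dunion (cycle_graph n) (cycle_graph n)) :=
  fun u v =>
  match u, v with
  | inl x, inr y | inr x, inl y => (val x == 0) && (val y == 0)
  | _, _ => false
  end.

Definition pan_edge : rel (dunion (cycle_graph n) (cycle_graph n)) :=
  fun u v => edge u v || pan_bridge u v.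

Lemma pan_edge_sym : symmetric pan_edge.
Proof.
move=> u v; rewrite /pan_edge edge_sym; congr (_ || _).
by move: u v => [x|x] [y|y] //=; rewrite andbC.
Qed.

Lemma pan_edge_irrefl : irreflexive pan_edge.
Proof. by move=> u; rewrite /pan_edge edge_irrefl; case: u. Qed.

Definition double_ended_pan : sgraph := SGraph pan_edge_sym pan_edge_irrefl.
End DoubleEndedPan.

(** * The graphs attached to binary words *)

(* The index [i] stands for the position [i.+1], and the letters 0 and 1 are
   [false] and [true]. *)
Definition positions (b : bool) (w : seq bool) : finType :=
  {i : 'I_(size w) | tnth (in_tuple w) i == b}.

Definition word_graph (w : seq bool) : sgraph :=
  dunion (double_ended_pan (size w + 6))
    (dunion
      (dsum (fun i : positions false w => cycle_graph ((val i).+1 + 6)))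
      (dsum (fun i : positions true w => compl (cycle_graph ((val i).+1 + 6))))).

Definition language_family (L : seq bool -> Prop) (H : sgraph) : Prop :=
  exists2 w : seq bool, L w & H = word_graph w.

(** * Decidability, by Kleene's partial recursive functions *)

Inductive recfun : nat -> Type :=
| RZero n : recfun n
| RSucc : recfun 1
| RProj n (i : 'I_n) : recfun n
| RComp m n (f : recfun m) (g : 'I_m -> recfun n) : recfun n
| RPrec n (f : recfun n) (g : recfun n.+2) : recfun n.+1
| RMu n (f : recfun n.+1) : recfun n.

(* [rec_eval f v y]: the computation of [f] on [v] halts with value [y].
   Recursion is on the first argument, [s] listing the successive values;
   minimisation requires all the values before the first zero to be defined. *)
Fixpoint rec_eval n (f : recfun n) : n.-tuple nat -> nat -> Prop :=
  match f in recfun n return n.-tuple nat -> nat -> Prop with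
  | RZero _ => fun _ y => y = 0
  | RSucc => fun v y => y = (thead v).+1
  | RProj _ i => fun v y => y = tnth v i
  | RComp m _ f g => fun v y =>
      exists2 u : m.-tuple nat,
        (forall i, rec_eval (g i) v (tnth u i)) & rec_eval f u y
  | RPrec _ f g => fun v y =>
      exists s : nat -> nat,
        [/\ rec_eval f [tuple of behead v] (s 0),
            forall k, k < thead v ->
              rec_eval g [tuple of k :: s k :: behead v] (s k.+1)
          & y = s (thead v)]
  | RMu _ f => fun v y =>
      rec_eval f [tuple of y :: v] 0 /\
      forall z, z < y -> exists k, rec_eval f [tuple of z :: v] k.+1
  end.

(* [P] is decided by a recursive function which, on the code of every instance,
   halts with output 1 or 0 according to whether [P] holds. *)
Definition decidable_via (T : Type) (n : nat) (code : T -> n.-tuple nat)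
    (P : T -> Prop) : Prop :=
  exists f : recfun n, forall x : T,
    exists2 b : bool, (b <-> P x) & rec_eval f (code x) b.

(* The number whose binary expansion is the digit 1 followed by [w]. *)
Definition word_code (w : seq bool) : 1.-tuple nat :=
  [tuple foldl (fun (a : nat) (b : bool) => a.*2 + b) 1 w].

(* The number of vertices, and the adjacency matrix read as a binary number,
   the vertices being numbered by the enumeration of the vertex type (for ['I_n]
   the natural one). *)
Definition graph_code (G : sgraph) : 2.-tuple nat :=
  [tuple #|vertex G|;
    \sum_(i < #|vertex G|) \sum_(j < #|vertex G|)
      edge (enum_val i : G) (enum_val j : G) * 2 ^ (i * #|vertex G| + j)].

Definition decidable_language (L : seq bool -> Prop) : Prop :=
  decidable_via word_code L.

Definition decidable_graph_problem (P : sgraph -> Prop) : Prop :=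
  decidable_via graph_code P.

(* Main.v *)
Require Import Defs.
From mathcomp Require Import all_boot zify.

(** The family is rigid: a full homomorphism from [word_graph w] to
    [word_graph u] forces [w = u].  Hence [word_graph w] is colourable exactly
    when [w] belongs to [L], and since a graph with the same colourability as
    [word_graph w] can be computed from [w], a decision procedure for the
    colouring problem would decide [L].

    Rigidity ([word_graph_rigid]).  Two vertices identified by a full
    homomorphism have the same neighbours, and no two vertices of a word graph
    do ([word_graph_twin_free]), so a full homomorphism [phi] is an embedding as
    an induced subgraph.  The two ends of the bridge of the pan are the only
    vertices with three pairwise non-adjacent neighbours ([grid_claw]): a vertex
    of a cycle has only two neighbours, and a cycle of length at least 7 has no
    triangle.  So [phi] maps bridge ends onto bridge ends.  These have degree 3
    and every other vertex of a pan has degree 2, hence the part of the target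
    pan covered by the source pan is closed under adjacency, and the source pan
    covers the target pan
    ([pan_covered]).  This gives [size u <= size w]; but then the second graph is
    no larger than the first, so [phi] is an isomorphism and the two words have
    the same length.  An isomorphism preserves degrees, and the letter at the
    index [i] is 1 exactly when some vertex has degree [i + 4], the degree in the
    complement of the cycle on [i + 7] vertices, all vertices outside the
    complements having degree at most 3 ([degree_spectrum]).

    Computation.  Colourability is not changed by duplicating vertices
    ([full_colourable_pullback]).  This allows the rows of vertices, one for each
    cycle or complement, to be padded to a common length, so that the vertex
    numbered [v] is found by one Euclidean division and the adjacency matrix is
    an explicit arithmetical expression in the number of the word; recursive
    functions are closed under all the operations that occur in it
    ([computable_code_matrix]). *)

Set Implicit Arguments.
Unset Strict Implicit.
Unset Printing Implicit Defensive.

(** * Adjacency in coordinates *)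

Definition cycle_adj n b c :=
  [|| b.+1 == c, c.+1 == b, (b == 0) && (c.+1 == n) | (c == 0) && (b.+1 == n)].

Arguments cycle_adj : simpl never.

Lemma cycle_edgeE n (i j : 'I_n) : 2 < n -> cycle_edge i j = cycle_adj n i j.
Proof.
move=> n_gt2; rewrite /cycle_edge /cycle_adj -!val_eqE /=.
have modS (k : 'I_n) : k.+1 %% n = if k.+1 == n then 0 else k.+1.
  case: eqP => [->|neq]; first by rewrite modnn.
  by rewrite modn_small //; have := ltn_ord k; lia.
rewrite !modS; have := ltn_ord i; have := ltn_ord j.
by case: (j.+1 =P n); case: (i.+1 =P n); lia.
Qed.

(** The vertices of a word graph are placed in rows: the two cycles of the pan in
    the rows 0 and 1, and the summand for the index [i] of the word in the row
    [i + 2], of length [i + 7]. *)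
Definition row_size m a := if a < 2 then m + 6 else a + 5.

Definition in_grid m (p : nat * nat) := (p.1 < m.+2) && (p.2 < row_size m p.1).

(** The row [a > 1] belongs to the letter at the index [a - 2]. *)
Definition grid_adj m (l : nat -> bool) (p q : nat * nat) :=
  if p.1 < 2 then
    (q.1 < 2) && (if p.1 == q.1 then cycle_adj (m + 6) p.2 q.2
                  else (p.2 == 0) && (q.2 == 0))
  else (p.1 == q.1) &&
    (if l (p.1 - 2) then (p.2 != q.2) && ~~ cycle_adj (p.1 + 5) p.2 q.2
     else cycle_adj (p.1 + 5) p.2 q.2).

Definition cycle_next n b := if b.+1 == n then 0 else b.+1.
Definition cycle_prev n b := if b == 0 then n.-1 else b.-1.

Lemma cycle_next_ltn n b : b < n -> cycle_next n b < n.
Proof. by rewrite /cycle_next; case: (b.+1 =P n); lia. Qed.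

Lemma cycle_prev_ltn n b : b < n -> cycle_prev n b < n.
Proof. by rewrite /cycle_prev; case: (b =P 0); lia. Qed.

Lemma cycle_adjE n b c : 2 < n -> b < n -> c < n ->
  cycle_adj n b c = (c == cycle_next n b) || (c == cycle_prev n b).
Proof.
rewrite /cycle_adj /cycle_next /cycle_prev => n_gt2 ltb ltc.
by case: (b.+1 =P n); case: (b =P 0); lia.
Qed.

Lemma cycle_adj_next n b : cycle_adj n b (cycle_next n b).
Proof. by rewrite /cycle_adj /cycle_next; case: (b.+1 =P n); lia. Qed.

Lemma cycle_adj_prev n b : 0 < n -> cycle_adj n b (cycle_prev n b).
Proof. by rewrite /cycle_adj /cycle_prev; case: (b =P 0); lia. Qed.

Lemma cycle_adj_two n b c1 c2 c3 : 2 < n ->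
    b < n -> c1 < n -> c2 < n -> c3 < n ->
    cycle_adj n b c1 -> cycle_adj n b c2 -> cycle_adj n b c3 ->
  [|| c1 == c2, c1 == c3 | c2 == c3].
Proof.
move=> n_gt2 ltb lt1 lt2 lt3; rewrite !cycle_adjE //.
by do 3!case/orP=> /eqP->; rewrite !eqxx ?orbT.
Qed.

Lemma cycle_adj_triangle n c1 c2 c3 : 3 < n ->
    c1 < n -> c2 < n -> c3 < n -> c2 != c3 ->
    cycle_adj n c1 c2 -> cycle_adj n c1 c3 -> ~~ cycle_adj n c2 c3.
Proof.
move=> n_gt3 lt1 lt2 lt3 neq23; have n_gt2 : 2 < n by lia.
rewrite !cycle_adjE // => adj12 adj13; apply/negP => adj23.
move: adj12 adj13 adj23; rewrite /cycle_next /cycle_prev.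
by case: (c1.+1 =P n); case: (c1 =P 0); case: (c2.+1 =P n); case: (c2 =P 0); lia.
Qed.

(** A common neighbourhood contains both [cycle_next n b] and [cycle_prev n b],
    and two distinct vertices have two common neighbours only in the 4-cycle. *)
Lemma cycle_twin_free n b c : 4 < n -> b < n -> c < n ->
  (forall d, d < n -> cycle_adj n b d = cycle_adj n c d) -> b = c.
Proof.
move=> n_gt4 ltb ltc twin; have [n_gt2 n_gt0] : 2 < n /\ 0 < n by lia.
have := twin _ (cycle_next_ltn ltb); have := twin _ (cycle_prev_ltn ltb).
rewrite cycle_adj_next cycle_adj_prev //.
rewrite !cycle_adjE ?cycle_prev_ltn ?cycle_next_ltn //.
move=> /esym/orP hp /esym/orP hn.
move: hp hn; rewrite /cycle_next /cycle_prev.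
by case: (b.+1 =P n); case: (b =P 0); case: (c.+1 =P n); case: (c =P 0); lia.
Qed.

(** Non-adjacent vertices of the complement are adjacent in the cycle, and have
    there the same closed neighbourhood only in a triangle. *)
Lemma cocycle_twin_free n b c : 4 < n -> b < n -> c < n ->
  (forall d, d < n ->
     (b != d) && ~~ cycle_adj n b d = (c != d) && ~~ cycle_adj n c d) ->
  b = c.
Proof.
move=> n_gt4 ltb ltc twin; have [n_gt2 n_gt0] : 2 < n /\ 0 < n by lia.
have {}twin d : d < n -> cycle_adj n b d || (b == d) -> cycle_adj n c d || (c == d).
  by move=> /twin; case: (b == d); case: (c == d);
     case: (cycle_adj n b d); case: (cycle_adj n c d).
have := twin _ ltb; have := twin _ (cycle_next_ltn ltb).
have := twin _ (cycle_prev_ltn ltb).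
rewrite cycle_adj_next cycle_adj_prev ?eqxx ?orbT //.
rewrite !cycle_adjE ?cycle_prev_ltn ?cycle_next_ltn //.
move=> /(_ isT) hp /(_ isT) hn /(_ isT) hb; move: hp hn hb.
rewrite /cycle_next /cycle_prev.
by case: (b.+1 =P n); case: (b =P 0); case: (c.+1 =P n); case: (c =P 0); lia.
Qed.

Section Grid.
Variables (m : nat) (l : nat -> bool).
Implicit Types p q r : nat * nat.
Local Notation adj := (grid_adj m l).
Local Notation in_grid := (in_grid m).

(** A vertex of a cycle other than a bridge end has at most two neighbours, and
    three pairwise non-adjacent vertices in the complement of a cycle would be a
    triangle of the cycle. *)
Lemma grid_claw p q1 q2 q3 :
    in_grid p -> in_grid q1 -> in_grid q2 -> in_grid q3 ->
    adj p q1 -> adj p q2 -> adj p q3 ->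
    q1 != q2 -> q1 != q3 -> q2 != q3 ->
    ~~ adj q1 q2 -> ~~ adj q1 q3 -> ~~ adj q2 q3 ->
  (p.1 < 2) && (p.2 == 0).
Proof.
case: p q1 q2 q3 => [a b] [a1 b1] [a2 b2] [a3 b3].
rewrite /in_grid /grid_adj /row_size !xpair_eqE /=.
have [a_lt2|a_ge2] := boolP (a < 2) => /andP[_ ltb]; last first.
  move=> g1 g2 g3 /andP[/eqP eq1 e1] /andP[/eqP eq2 e2] /andP[/eqP eq3 e3].
  subst a1 a2 a3.
  rewrite (negPf a_ge2) eqxx /= in g1 g2 g3 *.
  move: g1 g2 g3 => /andP[_ lt1] /andP[_ lt2] /andP[_ lt3].
  have n_gt3 : 3 < a + 5 by lia.
  move=> n12 n13 n23; case: (l (a - 2)) in e1 e2 e3 *.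
    rewrite n12 n13 n23 /= !negbK => adj12 adj13.
    by rewrite (negPf (cycle_adj_triangle n_gt3 lt1 lt2 lt3 n23 adj12 adj13)).
  have := cycle_adj_two (ltnW n_gt3) ltb lt1 lt2 lt3 e1 e2 e3.
  by rewrite (negPf n12) (negPf n13) (negPf n23).
move=> g1 g2 g3 /andP[a1_lt2 e1] /andP[a2_lt2 e2] /andP[a3_lt2 e3].
rewrite a1_lt2 a2_lt2 a3_lt2 in g1 g2 g3 *.
move: g1 g2 g3 => /andP[_ lt1] /andP[_ lt2] /andP[_ lt3] n12 n13 n23 _ _ _.
apply/negPn/negP => /= b_neq0; rewrite (negPf b_neq0) /= in e1 e2 e3.
move: e1 e2 e3 n12 n13 n23.
case: (a =P a1) => // <- e1; case: (a =P a2) => // <- e2.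
case: (a =P a3) => // _ e3.
move=> /= n12 n13 n23; have n_gt2 : 2 < m + 6 by lia.
have := cycle_adj_two n_gt2 ltb lt1 lt2 lt3 e1 e2 e3.
by rewrite (negPf n12) (negPf n13) (negPf n23).
Qed.

(** Separates vertices of different rows by a neighbour of [q] in its own row.
    When both rows belong to the pan, this neighbour has to avoid the bridge end,
    which may be adjacent to [p]. *)
Lemma grid_row_neighbour p q : in_grid q -> p.1 != q.1 ->
  exists2 r, in_grid r & adj q r && ~~ adj p r.
Proof.
case: p q => [a b] [c d] /= gq neq_ac.
have [ltc ltd] := andP gq; rewrite /= in ltc ltd.
have in_row e : e < row_size m c -> in_grid (c, e) by rewrite /in_grid ltc.
have gN := cycle_next_ltn ltd; have gP := cycle_prev_ltn ltd.
have [c_lt2|c_ge2] := boolP (c < 2).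
  rewrite /row_size c_lt2 in ltd in_row gN gP.
  have [d_m|d_Nm] := eqVneq d.+1 (m + 6).
    exists (c, cycle_prev (m + 6) d); first exact: in_row.
    rewrite /grid_adj /= c_lt2 eqxx cycle_adj_prev ?addnS // (negPf neq_ac) /=.
    by case: ifP => _; [|lia]; rewrite negb_and /cycle_prev; case: (d =P 0); lia.
  exists (c, cycle_next (m + 6) d); first exact: in_row.
  rewrite /grid_adj /= c_lt2 eqxx cycle_adj_next (negPf neq_ac) /=.
  by case: ifP => _; [|lia]; rewrite negb_and /cycle_next (negPf d_Nm) orbT.
have far e : ~~ adj (a, b) (c, e).
  by rewrite /grid_adj /= (negPf neq_ac) /= (negPf c_ge2); case: ifP.
rewrite /row_size (negPf c_ge2) in ltd in_row gN gP.
pose e := if l (c - 2) then cycle_next (c + 5) (cycle_next (c + 5) d)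
          else cycle_next (c + 5) d.
exists (c, e).
  by apply: in_row; rewrite /e; case: ifP => _ //; apply: cycle_next_ltn.
rewrite far andbT /grid_adj /= (negPf c_ge2) eqxx /= /e.
case: (l (c - 2)); last exact: cycle_adj_next.
rewrite /cycle_adj /cycle_next; case: (d.+1 =P c + 5) => h1.
  by case: (1 =P c + 5); lia.
by case: (d.+2 =P c + 5) => h2; lia.
Qed.

Lemma grid_twin_free p q : in_grid p -> in_grid q ->
  (forall r, in_grid r -> adj p r = adj q r) -> p = q.
Proof.
move=> gp gq twin.
have eq_row : p.1 = q.1.
  apply/eqP/negPn/negP => /(grid_row_neighbour gq)[r gr].
  by rewrite twin // andbN.
case: p q => [a b] [c d] /= in gp gq twin eq_row *; rewrite -eq_row in gq twin *.
have [lta ltb] := andP gp; have [_ ltd] := andP gq.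
have {}twin e : e < row_size m a -> adj (a, b) (a, e) = adj (a, d) (a, e).
  by move=> lte; apply: twin; rewrite /in_grid lta.
rewrite /grid_adj /row_size /= eqxx in ltb ltd twin.
congr (_, _); case: (ltnP a 2) ltb ltd twin => [_|a_ge2] ltb ltd twin.
  by apply: cycle_twin_free ltb ltd twin; lia.
case: (l (a - 2)) twin => twin.
  by apply: cocycle_twin_free ltb ltd twin; lia.
by apply: cycle_twin_free ltb ltd twin; lia.
Qed.

End Grid.

(** * Coordinates and degrees in the graph of a word *)

Section Coordinates.
Variable w : seq bool.
Implicit Types x y : word_graph w.

Definition coord x : nat * nat :=
  match x with
  | inl (inl i) => (0, val i)
  | inl (inr i) => (1, val i)
  | inr (inl u) => ((val (tag u)).+2, val (tagged u))
  | inr (inr u) => ((val (tag u)).+2, val (tagged u))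
  end.

Lemma tnth_positions b (i : positions b w) : nth false w (sval i) = b.
Proof. by case: i => i /= /eqP <-; rewrite (tnth_nth false). Qed.

Lemma edge_coord x y :
  edge x y = grid_adj (size w) (nth false w) (coord x) (coord y).
Proof.
have pan_n : 2 < size w + 6 by lia.
have row_n (i : nat) : 2 < i.+1 + 6 by lia.
have neq_positions (i : positions true w) (j : positions false w) :
    sval i <> sval j :> nat.
  by move=> e; have := tnth_positions i; rewrite e tnth_positions.
move: x y => [[i|i]|[[i x]|[i x]]] [[j|j]|[[j y]|[j y]]] //=;
  rewrite /grid_adj /= ?subn2 /= ?eqSS //.
- by rewrite /pan_edge /= orbF cycle_edgeE.
- by rewrite /pan_edge /= orbF cycle_edgeE.
- rewrite tnth_positions /dsum_edge -!val_eqE /=.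
  case: eqP => //= eq_ij; have {}eq_ij : i = j by do 2!apply: val_inj.
  by case: j / eq_ij y => y; rewrite tagged_asE cycle_edgeE // [_.+2 + 5]addSnnS.
- by apply/esym/negP => /andP[/eqnP/esym/neq_positions].
- by apply/esym/negP => /andP[/eqnP/neq_positions].
- rewrite tnth_positions /dsum_edge -!val_eqE /=.
  case: eqP => //= eq_ij; have {}eq_ij : i = j by do 2!apply: val_inj.
  by case: j / eq_ij y => y; rewrite tagged_asE /= /compl_edge /=
    cycle_edgeE // [_.+2 + 5]addSnnS.
Qed.

Lemma coord_inj : injective coord.
Proof.
have neq_positions (i : positions true w) (j : positions false w) :
    sval i <> sval j :> nat.
  by move=> e; have := tnth_positions i; rewrite e tnth_positions.
move=> [[i|i]|[[i x]|[i x]]] [[j|j]|[[j y]|[j y]]] //= [].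
- by move/val_inj->.
- by move/val_inj->.
- move=> eq_ij; have {}eq_ij : i = j by do 2!apply: val_inj.
  by case: j / eq_ij y => y /val_inj ->.
- by move/esym/neq_positions.
- by move/neq_positions.
- move=> eq_ij; have {}eq_ij : i = j by do 2!apply: val_inj.
  by case: j / eq_ij y => y /val_inj ->.
Qed.

Lemma coord_in_grid x : in_grid (size w) (coord x).
Proof.
case: x => [[i|i]|[[i x]|[i x]]] /=; rewrite /in_grid /row_size /=.
- exact: ltn_ord.
- exact: ltn_ord.
- by rewrite [_.+2 + 5]addSnnS ltn_ord andbT; apply: (ltn_ord (val i)).
- by rewrite [_.+2 + 5]addSnnS ltn_ord andbT; apply: (ltn_ord (val i)).
Qed.

Lemma coord_onto p : in_grid (size w) p -> exists x, coord x = p.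
Proof.
case: p => [[|[|a]] b]; rewrite /in_grid /row_size /=.
- by move=> ltb; exists (inl (inl (Ordinal ltb))).
- by move=> ltb; exists (inl (inr (Ordinal ltb))).
rewrite addSnnS => /andP[lta ltb]; rewrite 2!ltnS in lta.
have /= pos c : nth false w a = c -> exists i : positions c w, val (val i) = a.
  move=> wa; have tnth_wa : tnth (in_tuple w) (Ordinal lta) == c.
    by rewrite (tnth_nth false) /= wa.
  by exists (exist (fun i => is_true (tnth (in_tuple w) i == c)) _ tnth_wa).
case wa: (nth false w a); have [i /= eq_ia] := pos _ wa; subst a.
  by exists (inr (inr (Tagged (fun i : positions true w =>
    compl (cycle_graph ((val i).+1 + 6))) (Ordinal ltb : compl (cycle_graph _))))).
by exists (inr (inl (Tagged (fun i : positions false w =>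
    cycle_graph ((val i).+1 + 6)) (Ordinal ltb : cycle_graph _)))).
Qed.

Definition origin : word_graph w :=
  inl (inl (Ordinal (leq_trans (ltn0Sn 5) (leq_addl (size w) 6)))).

Definition vertex_at (p : nat * nat) : word_graph w :=
  odflt origin [pick x | coord x == p].

Lemma vertex_atK p : in_grid (size w) p -> coord (vertex_at p) = p.
Proof.
move=> /coord_onto[x xP]; rewrite /vertex_at; case: pickP => [y /eqP //|].
by move/(_ x); rewrite xP eqxx.
Qed.

Lemma coordK : cancel coord vertex_at.
Proof. by move=> x; apply/coord_inj/vertex_atK/coord_in_grid. Qed.

Lemma word_graph_twin_free x y : (forall z, edge x z = edge y z) -> x = y.
Proof.
move=> twin; apply/coord_inj/(grid_twin_free (l := nth false w)).
- exact: coord_in_grid.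
- exact: coord_in_grid.
by move=> r /coord_onto[z <-]; rewrite -!edge_coord.
Qed.

Definition degree x := #|[set y | edge x y]|.

(** All of the [a + 5] vertices of the row are neighbours, except the vertex
    itself and its two neighbours in the cycle. *)
Lemma degree_cocycle a b : 1 < a < (size w).+2 -> nth false w (a - 2) ->
  b < a + 5 -> degree (vertex_at (a, b)) = a + 2.
Proof.
move=> /andP[a_ge2 lta] wa ltb; set n := a + 5 in ltb *.
have n_gt2 : 2 < n by rewrite /n; lia.
have gridE c : c < n -> in_grid (size w) (a, c).
  by rewrite /in_grid /row_size /= lta (leq_gtF a_ge2).
pose f (j : 'I_n) := vertex_at (a, val j).
have coord_f j : coord (f j) = (a, val j).
  by rewrite vertex_atK //; exact/gridE/ltn_ord.
have f_inj : injective f.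
  by move=> i j /(congr1 coord); rewrite !coord_f => -[] /val_inj.
pose N := [set Ordinal ltb; Ordinal (cycle_next_ltn ltb);
               Ordinal (cycle_prev_ltn ltb)].
have cardN : #|N| = 3.
  rewrite /N -setUA cardsU1 cards2 !inE -!val_eqE /= /cycle_next /cycle_prev.
  by case: (b.+1 =P n); case: (b =P 0); lia.
have -> : degree (vertex_at (a, b)) = #|f @: ~: N|.
  congr #|pred_of_set _|; apply/setP => y; rewrite !inE edge_coord vertex_atK ?gridE //.
  rewrite /grid_adj /= (leq_gtF a_ge2) wa.
  apply/idP/imsetP => [/andP[/eqP eq_a /andP[neq_b]]|[j + ->]].
    have lty : (coord y).2 < n.
      have /andP[_] := coord_in_grid y.
      by rewrite /row_size -eq_a (leq_gtF a_ge2).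
    rewrite cycle_adjE // => /norP[neqN neqP].
    exists (Ordinal lty); last first.
      by apply: coord_inj; rewrite coord_f [LHS]surjective_pairing -eq_a.
    by rewrite !inE -!val_eqE /= !negb_or (eq_sym _ b) neq_b neqN.
  rewrite coord_f !inE -!val_eqE /= cycle_adjE // eqxx (eq_sym b) !negb_or.
  by rewrite -andbA.
rewrite card_imset // cardsCs setCK cardN card_ord /n; lia.
Qed.

Lemma degree_le3 x :
  ~~ ((1 < (coord x).1) && nth false w ((coord x).1 - 2)) -> degree x <= 3.
Proof.
case eq_x: (coord x) => [a b] /= low.
have := coord_in_grid x; rewrite eq_x => /andP[/= lta ltb].
pose n := row_size (size w) a.
(* The third vertex is the possible neighbour along the bridge. *)
pose N := [set vertex_at (a, cycle_next n b); vertex_at (a, cycle_prev n b);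
               vertex_at (1 - a, 0)].
have n_gt2 : 2 < n by rewrite /n /row_size; case: ifP; lia.
suff /subset_leq_card/leq_trans-> : [set y | edge x y] \subset N => //.
  by rewrite /N setUC cardsU1 cards2; case: (_ \notin _); case: (_ != _).
apply/subsetP => y; rewrite !inE edge_coord eq_x.
case eq_y: (coord y) => [c d]; have := coord_in_grid y; rewrite eq_y => /andP[/= ltc ltd].
have -> : y = vertex_at (c, d) by rewrite -eq_y coordK.
rewrite /grid_adj /= in ltd *; case: (ltnP a 2) low => [a_lt2 _|a_ge2 /= /negPf->].
  move=> /andP[c_lt2]; case: eqP => [eq_ac|neq_ac].
    subst c; rewrite -/n in ltb ltd.
    move=> adj_bd; have : cycle_adj n b d by rewrite /n /row_size a_lt2.
    by rewrite cycle_adjE //; case/orP=> /eqP->; rewrite eqxx ?orbT.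
  by case/andP=> _ /eqP->; have -> : c = 1 - a by [lia]; rewrite eqxx !orbT.
move=> /andP[/eqP eq_ac]; subst c; rewrite -/n in ltb ltd.
move=> adj_bd; have : cycle_adj n b d by rewrite /n /row_size ltnNge a_ge2.
by rewrite cycle_adjE //; case/orP=> /eqP->; rewrite eqxx ?orbT.
Qed.

(** The word is recovered from the degrees: the complements in different rows
    have different degrees, all greater than 3. *)
Lemma degree_spectrum i :
  (exists x, degree x = i + 4) <-> nth false w i.
Proof.
split=> [[x deg_x]|wi]; last first.
  have lti : i < size w by rewrite ltnNge; apply: contraL wi => /(nth_default _)->.
  exists (vertex_at (i.+2, 0)); rewrite degree_cocycle //; first by lia.
  by rewrite subn2.
have [|/degree_le3] := boolP ((1 < (coord x).1) && nth false w ((coord x).1 - 2));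
  last by lia.
have := coord_in_grid x; have := coordK x.
case: (coord x) => a b /= eq_x; subst x.
move=> /andP[/= lta ltb] /andP[a_ge2 wa].
rewrite /row_size (leq_gtF a_ge2) in ltb.
rewrite degree_cocycle ?a_ge2 // in deg_x.
by rewrite (_ : i = a - 2) //; lia.
Qed.

End Coordinates.

(** * Rigidity of the graphs of words *)

Definition in_pan (p : nat * nat) := p.1 < 2.
Definition bridge_end (p : nat * nat) := (p.1 < 2) && (p.2 == 0).

Lemma degree_pan w (x : word_graph w) :
  in_pan (coord x) -> degree x = 2 + bridge_end (coord x).
Proof.
rewrite /in_pan /bridge_end => pan_x; rewrite pan_x /=.
have := coord_in_grid x; have := coordK x; have {pan_x} := pan_x.
case: (coord x) => a b /= a_lt2 eq_x; subst x.
rewrite /in_grid /row_size /= a_lt2 => /andP[lta ltb].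
set n := size w + 6 in ltb.
have n_gt2 : 2 < n by rewrite /n; lia.
have gridE c d : c < 2 -> d < n -> in_grid (size w) (c, d).
  by rewrite /in_grid /row_size /= => c_lt2; rewrite c_lt2 (leq_trans c_lt2).
have [ltN ltP] := (cycle_next_ltn ltb, cycle_prev_ltn ltb).
have [a'_lt2 n_gt0] : 1 - a < 2 /\ 0 < n by lia.
have neq_at p q : in_grid (size w) p -> in_grid (size w) q -> p != q ->
    vertex_at w p != vertex_at w q.
  by move=> gp gq; apply: contra => /eqP/(congr1 (@coord w));
    rewrite !vertex_atK // => ->.
pose row_nbrs := [set vertex_at w (a, cycle_next n b);
                      vertex_at w (a, cycle_prev n b)].
have card_row : #|row_nbrs| = 2.
  rewrite cards2 neq_at ?gridE // xpair_eqE eqxx /cycle_next /cycle_prev.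
  by case: (b.+1 =P n); case: (b =P 0); lia.
have row_nbrsP y :
    ((coord y).1 == a) && cycle_adj n b (coord y).2 = (y \in row_nbrs).
  rewrite !inE; have := coord_in_grid y; have := coordK y.
  case: (coord y) => c d /= <- {y} gy.
  have [eq_ca|neq_ca] := eqVneq c a; last first.
    by symmetry; apply/negbTE; rewrite negb_or !neq_at ?gy ?gridE //
      xpair_eqE (negPf neq_ca).
  subst c; have /andP[_] := gy; rewrite /row_size a_lt2 => /= ltd; rewrite cycle_adjE //.
  by rewrite -!(inj_eq (@coord_inj w)) !vertex_atK ?gridE // !xpair_eqE eqxx.
rewrite /degree; case: eqVneq => [b0|b_neq0]; last first.
  rewrite addn0 -card_row; congr #|pred_of_set _|; apply/setP => y.
  rewrite -row_nbrsP inE edge_coord vertex_atK ?gridE // /grid_adj /= a_lt2.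
  rewrite (eq_sym a) (negPf b_neq0) /=; case: eqP => [->|_]; last by rewrite andbF.
  by rewrite a_lt2.
have -> : [set y | edge (vertex_at w (a, b)) y] = vertex_at w (1 - a, 0) |: row_nbrs.
  apply/setP => y; rewrite [RHS]in_setU1 -row_nbrsP inE edge_coord vertex_atK ?gridE //.
  rewrite /grid_adj /= a_lt2 (eq_sym a) b0 eqxx /=.
  rewrite -(inj_eq (@coord_inj w)) vertex_atK ?gridE //.
  case: (coord y) => c d; rewrite xpair_eqE /=.
  case: (c =P a) => [->|/eqP neq_ca]; first by
    rewrite a_lt2 /=; case: (a =P 1 - a) => //; lia.
  by rewrite /= orbF; case: (d == 0); rewrite ?andbT ?andbF //; lia.
rewrite cardsU1 card_row -row_nbrsP vertex_atK ?gridE //.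
by case: (1 - a =P a); lia.
Qed.

Lemma pan_closed w (x y : word_graph w) :
  in_pan (coord x) -> edge x y -> in_pan (coord y).
Proof. by rewrite edge_coord /grid_adj /in_pan => -> /andP[]. Qed.

Lemma card_pan w : #|[set x : word_graph w | in_pan (coord x)]| = 2 * (size w + 6).
Proof.
have -> : [set x : word_graph w | in_pan (coord x)] = [set inl x | x in setT].
  apply/setP => -[x|x]; rewrite inE.
    by rewrite imset_f ?inE //; case: x.
  have -> : in_pan (coord (inr x : word_graph w)) = false by case: x.
  by symmetry; apply/imsetP => -[].
by rewrite card_imset ?cardsT ?card_sum ?card_ord ?mul2n ?addnn // => x y [].
Qed.

Lemma full_homE (G H : sgraph) (f : G -> H) :
  full_hom f -> forall x y, edge (f x) (f y) = edge x y.
Proof. by move=> f_full x y; apply/idP/idP => /f_full. Qed.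

Section Rigidity.
Variables (w u : seq bool) (phi : word_graph w -> word_graph u).
Hypothesis phi_full : full_hom phi.

Lemma full_hom_inj : injective phi.
Proof.
move=> x y eq_xy; apply: word_graph_twin_free => z.
by rewrite -!(full_homE phi_full) eq_xy.
Qed.

(** Having three pairwise non-adjacent neighbours is preserved by an induced
    embedding; for a bridge end these are its two neighbours in its cycle and the
    other bridge end. *)
Lemma full_hom_bridge_end x :
  bridge_end (coord x) -> bridge_end (coord (phi x)).
Proof.
have := coordK x; case: (coord x) => a b eq_x /andP[/= a_lt2 /eqP b0]; subst b.
have gridE c d : c < 2 -> d < size w + 6 -> in_grid (size w) (c, d).
  by rewrite /in_grid /row_size /= => c_lt2; rewrite c_lt2 (leq_trans c_lt2).
have [a'_lt2 lt1 ltL] : [/\ 1 - a < 2, 1 < size w + 6 & size w + 5 < size w + 6].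
  by split; lia.
have lt0 := ltnW lt1.
pose z1 := vertex_at w (a, 1); pose z2 := vertex_at w (a, size w + 5).
pose z3 := vertex_at w (1 - a, 0).
have zE := (vertex_atK (gridE _ _ a_lt2 lt1), vertex_atK (gridE _ _ a_lt2 ltL),
  vertex_atK (gridE _ _ a'_lt2 lt0), vertex_atK (gridE _ _ a_lt2 lt0)).
have neq_aa' : (a == 1 - a) = false by apply/eqP; lia.
have gphi z := coord_in_grid (phi z).
by apply: (grid_claw (gphi x) (gphi z1) (gphi z2) (gphi z3) (l := nth false u));
  rewrite -?edge_coord ?(full_homE phi_full) ?edge_coord
    ?(inj_eq (@coord_inj _)) ?(inj_eq full_hom_inj) -?(inj_eq (@coord_inj _)) -?eq_x
    !zE /grid_adj /cycle_adj ?xpair_eqE /= ?a_lt2 ?a'_lt2 ?eqxx ?neq_aa' /=; lia.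
Qed.

(** The two bridge ends are mapped injectively to the only two bridge ends. *)
Lemma bridge_end_covered a : a < 2 ->
  exists2 x, bridge_end (coord x) & coord (phi x) = (a, 0).
Proof.
move=> a_lt2; pose e c := vertex_at w (c, 0).
have coord_e c : c < 2 -> coord (e c) = (c, 0).
  by move=> c_lt2; rewrite vertex_atK // /in_grid /row_size /= c_lt2; lia.
have end_e c : c < 2 -> bridge_end (coord (e c)).
  by move=> c_lt2; rewrite coord_e // /bridge_end /= c_lt2.
have neq_e : coord (phi (e 0)) != coord (phi (e 1)).
  rewrite (inj_eq (@coord_inj _)) (inj_eq full_hom_inj) -(inj_eq (@coord_inj _)).
  by rewrite !coord_e.
have [c c_lt2 eq_c] : exists2 c, c < 2 & (coord (phi (e c))).1 = a.
  have end0 := full_hom_bridge_end (end_e 0 isT).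
  have end1 := full_hom_bridge_end (end_e 1 isT).
  have [eq0|neq0] := eqVneq (coord (phi (e 0))).1 a; first by exists 0.
  exists 1 => //; move: neq_e neq0 end0 end1.
  case: (coord (phi (e 0))) => c0 d0; case: (coord (phi (e 1))) => c1 d1.
  by rewrite xpair_eqE /bridge_end /=; lia.
exists (e c); first exact: end_e.
have /andP[_ /eqP] := full_hom_bridge_end (end_e c c_lt2).
by rewrite -eq_c => <-; case: (coord _).
Qed.

Lemma full_hom_bridge_endE x :
  bridge_end (coord (phi x)) = bridge_end (coord x).
Proof.
apply/idP/idP => [/andP[a_lt2 /eqP b0]|]; last exact: full_hom_bridge_end.
have [y end_y /eqP] := bridge_end_covered a_lt2.
rewrite -b0 -surjective_pairing (inj_eq (@coord_inj _)) (inj_eq full_hom_inj).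
by move=> /eqP <-.
Qed.

(** By induction along the cycle of the row [a], from the bridge end: the degrees
    of [x] and [phi x] agree, so [phi] maps the neighbours of [x] onto those of
    [phi x], among which is the next vertex of the row. *)
Lemma pan_covered a b : a < 2 -> b < size u + 6 ->
  exists2 x, in_pan (coord x) & coord (phi x) = (a, b).
Proof.
move=> a_lt2; elim: b => [_|b IHb ltb].
  by have [x /andP[pan_x _] eq_x] := bridge_end_covered a_lt2; exists x.
have gridE c : c < size u + 6 -> in_grid (size u) (a, c).
  by rewrite /in_grid /row_size /= a_lt2 => ->; rewrite (leq_trans a_lt2).
have [x pan_x eq_x] := IHb (ltnW ltb).
have pan_phi_x : in_pan (coord (phi x)) by rewrite eq_x.
have eqN : phi @: [set y | edge x y] = [set y | edge (phi x) y].
  apply/eqP; rewrite eqEcard card_imset; last exact: full_hom_inj.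
  have := degree_pan pan_phi_x; rewrite full_hom_bridge_endE -degree_pan //.
  rewrite /degree => ->; rewrite leqnn andbT; apply/subsetP => _ /imsetP[y + ->].
  by rewrite !inE (full_homE phi_full).
have : vertex_at u (a, b.+1) \in [set y | edge (phi x) y].
  rewrite inE edge_coord eq_x vertex_atK ?gridE // /grid_adj /= a_lt2 eqxx.
  by rewrite /cycle_adj eqxx.
rewrite -eqN => /imsetP[y]; rewrite inE => adj_xy eq_y.
by exists y; [exact: pan_closed adj_xy | rewrite -eq_y vertex_atK ?gridE].
Qed.

Lemma full_hom_size_leq : size u <= size w.
Proof.
suff : 2 * (size u + 6) <= 2 * (size w + 6) by lia.
rewrite -!card_pan -(card_imset _ full_hom_inj); apply/subset_leq_card/subsetP => y.
rewrite inE => pan_y; have := coord_in_grid y.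
rewrite /in_grid /row_size (pan_y : _ < 2) => /andP[_ /(pan_covered pan_y)[x pan_x]].
by rewrite -surjective_pairing => /coord_inj <-; rewrite imset_f ?inE.
Qed.

(** When [size u <= size w], the rows of the second graph are initial segments of
    rows of the first, and comparing coordinates embeds its vertices into those
    of the first.  Together with the injection [phi] this makes both maps
    bijective. *)
Lemma full_hom_bij : size u = size w /\ bijective phi.
Proof.
have le_uw := full_hom_size_leq.
have sub_grid p : in_grid (size u) p -> in_grid (size w) p.
  by rewrite /in_grid /row_size; case: ifP => _; lia.
pose psi (y : word_graph u) := vertex_at w (coord y).
have coord_psi y : coord (psi y) = coord y.
  exact/vertex_atK/sub_grid/coord_in_grid.
have psi_inj : injective psi.
  by move=> y z /(congr1 (@coord w)); rewrite !coord_psi => /coord_inj.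
have le_card_uw := leq_card psi psi_inj; have le_card_wu := leq_card phi full_hom_inj.
split; last exact: inj_card_bij full_hom_inj le_card_uw.
have [psi' psiK psi'K] := inj_card_bij psi_inj le_card_wu.
apply/eqP; rewrite eqn_leq le_uw /=.
(* The last vertex of a pan cycle of the first graph has to occur in the second. *)
have gL : in_grid (size w) (0, size w + 5) by rewrite /in_grid /row_size /=; lia.
have := coord_in_grid (psi' (vertex_at w (0, size w + 5))).
by rewrite -coord_psi psi'K vertex_atK // /in_grid /row_size /=; lia.
Qed.

Theorem word_graph_rigid : w = u.
Proof.
have [eq_size [phi' phiK phi'K]] := full_hom_bij.
have deg_phi x : degree (phi x) = degree x.
  rewrite /degree -(card_imset _ full_hom_inj); congr #|pred_of_set _|.
  apply/setP => y; rewrite -[y]phi'K (mem_imset _ _ full_hom_inj) !inE.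
  exact: full_homE.
apply: (eq_from_nth (x0 := false)) => // i _.
apply/idP/idP => /degree_spectrum[x deg_x]; apply/degree_spectrum.
  by exists (phi x); rewrite deg_phi.
by exists (phi' x); rewrite -deg_phi phi'K.
Qed.

End Rigidity.

(** * Closure properties of recursive functions *)

(** A recursive function has a fixed arity, but its meaning is given here by a
    function on lists, so that binding a further variable, as in sums and
    recursion, is just [cons]. *)
Definition computable n (F : seq nat -> nat) : Prop :=
  exists f : recfun n, forall v : n.-tuple nat, rec_eval f v (F v).

Lemma computable_ext n (F G : seq nat -> nat) :
  (forall v : n.-tuple nat, F v = G v) -> computable n F -> computable n G.
Proof. by move=> eFG [f fP]; exists f => v; rewrite -eFG. Qed.

Lemma computable_comp n m F (H : seq nat -> seq nat) :
  (forall v : n.-tuple nat, size (H v) = m) -> computable m F ->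
  (forall i, i < m -> computable n (fun v => nth 0 (H v) i)) ->
  computable n (fun v => F (H v)).
Proof.
move=> szH [f fP] HP.
have [g gP] : exists g : 'I_m -> recfun n, forall i (v : n.-tuple nat),
    rec_eval (g i) v (nth 0 (H v) i).
  exact: fin_all_exists (fun i : 'I_m => HP i (ltn_ord i)).
exists (RComp f g) => v /=.
have szHv : size (H v) == m by rewrite szH.
exists (Tuple szHv); last exact: fP.
by move=> i; rewrite (tnth_nth 0); apply: gP.
Qed.

Lemma computable_nth n i : i < n -> computable n (fun v => nth 0 v i).
Proof.
by move=> ltin; exists (RProj (Ordinal ltin)) => v /=; rewrite (tnth_nth 0).
Qed.

Lemma computable_head n : computable n.+1 (head 0).
Proof.
apply: computable_ext (computable_nth (ltn0Sn n)) => v.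
by rewrite nth0.
Qed.

Lemma computable_behead n F :
  computable n F -> computable n.+1 (fun v => F (behead v)).
Proof.
move=> cF; apply: (computable_comp (m := n)) => // [v|i ltin].
  by rewrite size_behead size_tuple.
apply: computable_ext (computable_nth (_ : i.+1 < n.+1)) => // v.
by rewrite nth_behead.
Qed.

Lemma computable_subst n B F :
  computable n B -> computable n.+1 F -> computable n (fun v => F (B v :: v)).
Proof.
move=> cB cF; apply: (computable_comp (m := n.+1)) => // [v|[|i] ltin] //=.
  by rewrite size_tuple.
exact: computable_nth.
Qed.

Lemma computable_succ n F : computable n F -> computable n (fun v => (F v).+1).
Proof.
move=> cF; apply: (@computable_comp n 1 (fun v => (head 0 v).+1)
  (fun v => [:: F v])) => // [|[|i]] //.
by exists RSucc => v /=; case/tupleP: v => x v; rewrite theadE.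
Qed.

Lemma computable_const n k : computable n (fun=> k).
Proof.
elim: k => [|k IHk]; last exact: computable_succ IHk.
by exists (RZero n) => v.
Qed.

Lemma computable_nat_rect n B (A : seq nat -> nat)
    (G : nat -> nat -> seq nat -> nat) :
  computable n B -> computable n A ->
  computable n.+2 (fun v => G (head 0 v) (head 0 (behead v)) (behead (behead v))) ->
  computable n (fun v => nat_rect (fun=> nat) (A v) (fun k s => G k s v) (B v)).
Proof.
move=> cB [a aP] [g gP].
apply: (computable_subst (F := fun u => nat_rect (fun=> nat) (A (behead u))
  (fun k s => G k s (behead u)) (head 0 u)) cB).
exists (RPrec a g) => v /=.
exists (nat_rect (fun=> nat) (A (behead v)) (fun k s => G k s (behead v))).
split=> [|k _ /=|].
- exact: aP.
- exact: gP [tuple of k :: _ :: behead v].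
- by case/tupleP: v => x v; rewrite theadE.
Qed.

Lemma computable_pred n F : computable n F -> computable n (fun v => (F v).-1).
Proof.
move=> cF; have c0 := computable_const n 0.
apply: computable_ext (computable_nat_rect (G := fun k _ _ => k) cF c0 _) => [v|].
  by case: (F v).
exact: computable_head.
Qed.

Section Arithmetic.
Variables (n : nat) (F G : seq nat -> nat).
Hypotheses (cF : computable n F) (cG : computable n G).

Lemma computable_add : computable n (fun v => F v + G v).
Proof.
apply: computable_ext (computable_nat_rect (G := fun _ s _ => s.+1) cF cG _).
  by move=> v; elim: (F v) => //= k ->.
exact/computable_succ/computable_behead/computable_head.
Qed.

Lemma computable_sub : computable n (fun v => F v - G v).
Proof.
apply: computable_ext (computable_nat_rect (G := fun _ s _ => s.-1) cG cF _).
  by move=> v; elim: (G v) => [|k /= ->]; rewrite ?subn0 ?subnS.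
exact/computable_pred/computable_behead/computable_head.
Qed.

End Arithmetic.

(** Bounded sums replace bounded search: comparisons are 0-1-valued, and a sum of
    comparisons counts. *)
Lemma computable_sum n B (F : nat -> seq nat -> nat) :
  computable n B -> computable n.+1 (fun v => F (head 0 v) (behead v)) ->
  computable n (fun v => \sum_(i < B v) F i v).
Proof.
move=> cB cF; have c0 := computable_const n 0.
apply: computable_ext (computable_nat_rect (G := fun k s v => s + F k v) cB c0 _).
  by move=> v; elim: (B v) => [|k /= ->]; rewrite ?big_ord0 ?big_ord_recr.
apply: computable_add; first exact/computable_behead/computable_head.
apply: (@computable_comp _ n.+1 (fun v => F (head 0 v) (behead v))
  (fun v => head 0 v :: behead (behead v))) => // [v|[|i] ltin] //=.
- by rewrite !size_behead size_tuple.
- exact: computable_head.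
- exact: computable_behead (computable_behead (computable_nth (_ : i < n))).
Qed.

Lemma computable_mul n F G :
  computable n F -> computable n G -> computable n (fun v => F v * G v).
Proof.
move=> cF cG.
apply: computable_ext (computable_sum (F := fun _ => G) cF (computable_behead cG)).
by move=> v; rewrite sum_nat_const card_ord.
Qed.

Lemma computable_exp2 n F : computable n F -> computable n (fun v => 2 ^ F v).
Proof.
move=> cF; have c1 := computable_const n 1.
apply: computable_ext (computable_nat_rect (G := fun _ s _ => s + s) cF c1 _).
  by move=> v; elim: (F v) => //= k ->; rewrite expnS mul2n addnn.
by apply: computable_add; exact/computable_behead/computable_head.
Qed.

Section Predicates.
Variables (n : nat).
Implicit Types (F G : seq nat -> nat) (P Q R : seq nat -> bool).

Lemma computable_leq F G : computable n F -> computable n G ->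
  computable n (fun v => F v <= G v).
Proof.
move=> cF cG.
apply: computable_ext (computable_sub (computable_const n 1) (computable_sub cF cG)).
by move=> v; lia.
Qed.

Lemma computable_negb P : computable n P -> computable n (fun v => ~~ P v).
Proof.
move=> cP; apply: computable_ext (computable_sub (computable_const n 1) cP).
by move=> v; case: (P v).
Qed.

Lemma computable_andb P Q : computable n P -> computable n Q ->
  computable n (fun v => P v && Q v).
Proof.
move=> cP cQ; apply: computable_ext (computable_mul cP cQ) => v.
by rewrite mulnb.
Qed.

Lemma computable_orb P Q : computable n P -> computable n Q ->
  computable n (fun v => P v || Q v).
Proof.
move=> cP cQ.
apply: computable_ext
  (computable_negb (computable_andb (computable_negb cP) (computable_negb cQ))).
by move=> v; rewrite negb_and !negbK.
Qed.

Lemma computable_eqn F G : computable n F -> computable n G ->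
  computable n (fun v => F v == G v).
Proof.
move=> cF cG.
apply: computable_ext (computable_andb (computable_leq cF cG) (computable_leq cG cF)).
by move=> v; rewrite eqn_leq.
Qed.

Lemma computable_ifb P Q R : computable n P -> computable n Q -> computable n R ->
  computable n (fun v => if P v then Q v else R v).
Proof.
move=> cP cQ cR.
apply: computable_ext (computable_orb (computable_andb cP cQ)
  (computable_andb (computable_negb cP) cR)).
by move=> v; case: (P v); rewrite ?orbF.
Qed.

End Predicates.

Lemma sum_ltn B m : \sum_(k < B) (k < m) = minn B m.
Proof.
elim: B => [|B IHB]; first by rewrite big_ord0 min0n.
by rewrite big_ord_recr /= IHB; lia.
Qed.

(** The quotient is the number of positive multiples of the divisor up to the
    dividend.  The condition [0 < D v] accounts for division by zero. *)
Lemma computable_div n F D : computable n F -> computable n D ->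
  computable n (fun v => F v %/ D v).
Proof.
move=> cF cD.
apply: (@computable_ext _ (fun v =>
  \sum_(q < F v) ((0 < D v) && (q.+1 * D v <= F v)))) => [v|].
  have [->|D_gt0] := posnP (D v).
    by rewrite divn0 big1.
  under eq_bigr => q _ do rewrite -leq_divRL //.
  by rewrite sum_ltn; apply/minn_idPr/leq_div.
have cF' := computable_behead cF; have cD' := computable_behead cD.
apply: (computable_sum (F := fun q v => (0 < D v) && (q.+1 * D v <= F v)) cF).
apply: computable_andb; apply: computable_leq => //.
  exact: computable_const.
exact/computable_mul/cD'/computable_succ/computable_head.
Qed.

Lemma computable_mod n F D : computable n F -> computable n D ->
  computable n (fun v => F v %% D v).
Proof.
move=> cF cD.
apply: computable_ext
  (computable_sub cF (computable_mul (computable_div cF cD) cD)) => v.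
by rewrite {1}(divn_eq (F v) (D v)) addKn.
Qed.

Lemma computable_odd n F : computable n F -> computable n (fun v => odd (F v)).
Proof.
move=> cF; apply: computable_ext (computable_mod cF (computable_const n 2)).
by move=> v; rewrite modn2.
Qed.

(** * Numbers of words *)

Definition word_num (w : seq bool) : nat :=
  foldl (fun (a : nat) (b : bool) => a.*2 + b) 1 w.

Lemma word_num_rcons w b : word_num (rcons w b) = (word_num w).*2 + b.
Proof. by rewrite /word_num -cats1 foldl_cat. Qed.

(** The length of a word is one less than the number of binary digits of its
    number, and its letters are these digits from the second on, read from the
    most significant one. *)
Definition num_length p := \sum_(k < p) (2 ^ k.+1 <= p).
Definition num_letter p i := odd (p %/ 2 ^ (num_length p - i.+1)).

Lemma word_num_bounds w : 2 ^ size w <= word_num w < 2 ^ (size w).+1.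
Proof.
elim/last_ind: w => // w b IHw.
by rewrite word_num_rcons size_rcons !expnS in IHw *; lia.
Qed.

Lemma num_lengthE w : num_length (word_num w) = size w.
Proof.
have /andP[le_2p lt_p2] := word_num_bounds w.
transitivity (\sum_(k < word_num w) (k < size w)).
  apply: eq_bigr => k _; congr (nat_of_bool _).
  apply/idP/idP => [le_kp | lt_kw].
    by rewrite -ltnS -(ltn_exp2l _ _ (ltnSn 1)) (leq_ltn_trans le_kp).
  by apply: leq_trans le_2p; rewrite leq_exp2l.
rewrite sum_ltn; apply/minn_idPr/(leq_trans _ le_2p)/ltnW/ltn_expl; lia.
Qed.

Lemma num_letterE w i : i < size w -> num_letter (word_num w) i = nth false w i.
Proof.
rewrite /num_letter num_lengthE.
elim/last_ind: w => // w b IHw; rewrite size_rcons ltnS nth_rcons.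
rewrite leq_eqVlt word_num_rcons => /predU1P[->|lt_iw].
  by rewrite subnn divn1 ltnn eqxx oddD odd_double oddb.
rewrite lt_iw -IHw // subSn // expnS divnMA; congr (odd (_ %/ _)).
by lia.
Qed.

Lemma computable_num_length n P :
  computable n P -> computable n (fun v => num_length (P v)).
Proof.
move=> cP; have cP' := computable_behead cP.
apply: (computable_sum (F := fun k v => 2 ^ k.+1 <= P v) cP).
exact/computable_leq/cP'/computable_exp2/computable_succ/computable_head.
Qed.

Lemma computable_num_letter n P I : computable n P -> computable n I ->
  computable n (fun v => num_letter (P v) (I v)).
Proof.
move=> cP cI; have cL := computable_num_length cP.
apply/computable_odd/computable_div => //.
exact/computable_exp2/computable_sub/computable_succ.
Qed.

(** * Padding and the reduction *)

Section Pullback.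
Variables (T : finType) (G : sgraph) (f : T -> G).

Definition pullback_edge : rel T := fun i j => edge (f i) (f j).

Lemma pullback_edge_sym : symmetric pullback_edge.
Proof. by move=> i j; apply: edge_sym. Qed.

Lemma pullback_edge_irrefl : irreflexive pullback_edge.
Proof. by move=> i; apply: edge_irrefl. Qed.

Definition pullback : sgraph := SGraph pullback_edge_sym pullback_edge_irrefl.

(** The pullback along a surjection duplicates vertices; a full homomorphism is
    carried in one direction along [f] and in the other along a section. *)
Lemma full_colourable_pullback (F : sgraph -> Prop) (g : G -> T) :
  cancel g f -> full_colourable F pullback <-> full_colourable F G.
Proof.
move=> gK; split=> -[H FH [phi phi_full]]; exists H => //.
  exists (phi \o g) => x y.
  by rewrite -{1}[x]gK -{1}[y]gK; apply: (phi_full (g x) (g y)).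
by exists (phi \o f) => i j; apply: (phi_full (f i) (f j)).
Qed.

End Pullback.

Lemma full_colourable_word_graph (L : seq bool -> Prop) w :
  full_colourable (language_family L) (word_graph w) <-> L w.
Proof.
split=> [[_ [u Lu ->] [phi phi_full]]|Lw].
  by rewrite (word_graph_rigid phi_full).
by exists (word_graph w); [exists w | exists id].
Qed.

Definition padded_size m := m.+2 * (m + 6).

(** The surplus vertices at the end of a row duplicate its vertex 0.  They cannot
    be left isolated, because in general no vertex of the target is
    non-adjacent to the whole image. *)
Definition pad m v : nat * nat :=
  let a := v %/ (m + 6) in
  (a, (v %% (m + 6) < row_size m a) * (v %% (m + 6))).

Lemma pad_in_grid m v : v < padded_size m -> in_grid m (pad m v).
Proof.
move=> ltv; have n_gt0 : 0 < m + 6 by lia.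
rewrite /in_grid /pad /= ltn_divLR // (ltv : _ < _ * _) /=.
have [lt_row|_] := boolP (v %% (m + 6) < row_size m (v %/ (m + 6))).
  by rewrite mul1n.
by rewrite /row_size; case: ifP; lia.
Qed.

Lemma pad_onto m p : in_grid m p -> exists2 v, v < padded_size m & pad m v = p.
Proof.
case: p => a b; rewrite /in_grid /= => /andP[lta ltb].
have ltb' : b < m + 6.
  by move: ltb; rewrite /row_size; case: ifP; lia.
exists (a * (m + 6) + b).
  by rewrite /padded_size; nia.
rewrite /pad divnMDl ?divn_small ?addn0 //; last by lia.
by rewrite modnMDl modn_small // ltb mul1n.
Qed.

Definition padded_word_graph w : sgraph :=
  pullback (fun i : 'I_(padded_size (size w)) => vertex_at w (pad (size w) i)).

Lemma full_colourable_padded F w :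
  full_colourable F (padded_word_graph w) <-> full_colourable F (word_graph w).
Proof.
have lift x : exists i : 'I_(padded_size (size w)), vertex_at w (pad (size w) i) = x.
  have [v ltv eq_v] := pad_onto (coord_in_grid x).
  by exists (Ordinal ltv); rewrite /= eq_v coordK.
have [g gK] := fin_all_exists lift.
exact: (@full_colourable_pullback _ _ _ F g gK).
Qed.

(** The word enters these functions through its number, the only input that a
    recursive function receives. *)
Definition code_size p := padded_size (num_length p).

Definition code_adj p i j :=
  grid_adj (num_length p) (num_letter p)
    (pad (num_length p) i) (pad (num_length p) j).

Definition code_matrix p :=
  \sum_(i < code_size p) \sum_(j < code_size p)
    code_adj p i j * 2 ^ (i * code_size p + j).

Lemma padded_edgeE w (i j : padded_word_graph w) :
  edge i j = code_adj (word_num w) i j.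
Proof.
rewrite /code_adj num_lengthE.
rewrite -[LHS]/(edge (vertex_at w (pad (size w) i)) (vertex_at w (pad (size w) j))).
rewrite edge_coord !vertex_atK ?pad_in_grid //; move: (pad_in_grid (ltn_ord i)).
case: (pad _ i) => a b /andP[/= lta _]; rewrite /grid_adj /=.
case: ltnP => // a_ge2; case: eqP => // _; rewrite num_letterE //; lia.
Qed.

Lemma graph_code_padded w :
  graph_code (padded_word_graph w) =
    [tuple code_size (word_num w); code_matrix (word_num w)].
Proof.
set G := padded_word_graph w; set p := word_num w.
have card_n : #|G| = code_size p by rewrite card_ord /code_size num_lengthE.
have matrix_E : \sum_(i < #|G|) \sum_(j < #|G|)
    edge (enum_val i : G) (enum_val j : G) * 2 ^ (i * #|G| + j) = code_matrix p.
  have enumE (i : 'I_#|G|) : enum_val i = i :> nat by rewrite enum_val_ord.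
  rewrite /code_matrix -!card_n; apply: eq_bigr => i _; apply: eq_bigr => j _.
  by rewrite padded_edgeE !enumE.
by apply: val_inj; congr [:: _; _].
Qed.

Section ComputableGrid.
Variable n : nat.
Implicit Types P A B C D : seq nat -> nat.

Lemma computable_cycle_adj N B D :
  computable n N -> computable n B -> computable n D ->
  computable n (fun v => cycle_adj (N v) (B v) (D v)).
Proof.
move=> cN cB cD; have c0 := computable_const n 0.
have [cB1 cD1] := (computable_succ cB, computable_succ cD).
by apply: computable_orb; [|apply: computable_orb; [|apply: computable_orb]];
  do ?apply: computable_andb; apply: computable_eqn.
Qed.

Lemma computable_grid_adj P A B C D :
  computable n P -> computable n A -> computable n B ->
  computable n C -> computable n D ->
  computable n (fun v => grid_adj (num_length (P v)) (num_letter (P v))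
                           (A v, B v) (C v, D v)).
Proof.
move=> cP cA cB cC cD; rewrite /grid_adj /=.
have cst k := computable_const n k.
have [cL cA2] := (computable_num_length cP, computable_sub cA (cst 2)).
have cA5 := computable_add cA (cst 5).
apply: computable_ifb.
- by apply: computable_leq; [apply: computable_succ|].
- apply: computable_andb.
    by apply: computable_leq; [apply: computable_succ|].
  apply: computable_ifb; first exact: computable_eqn.
    by apply: computable_cycle_adj => //; apply: computable_add.
  by apply: computable_andb; apply: computable_eqn.
- apply: computable_andb; first exact: computable_eqn.
  apply: computable_ifb; first exact: computable_num_letter.
    apply: computable_andb; apply: computable_negb; first exact: computable_eqn.
    exact: computable_cycle_adj.
  exact: computable_cycle_adj.
Qed.

Lemma computable_code_size P :
  computable n P -> computable n (fun v => code_size (P v)).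
Proof.
move=> /computable_num_length cL; apply: computable_mul.
  exact/computable_succ/computable_succ.
exact/computable_add/computable_const.
Qed.

Lemma computable_code_adj P I J :
  computable n P -> computable n I -> computable n J ->
  computable n (fun v => code_adj (P v) (I v) (J v)).
Proof.
move=> cP cI cJ; have cL := computable_num_length cP.
have cst k := computable_const n k.
have cL6 := computable_add cL (cst 6).
have cRow A : computable n A ->
    computable n (fun v => row_size (num_length (P v)) (A v)).
  move=> cA; have cA5 := computable_add cA (cst 5).
  have c2 : computable n (fun v => A v < 2).
    by apply: computable_leq; [apply: computable_succ|].
  apply: computable_ext (computable_add (computable_mul c2 cL6)
    (computable_mul (computable_negb c2) cA5)) => v.
  by rewrite /row_size; case: (A v < 2); rewrite ?mul1n ?mul0n ?addn0.
have cPad1 K : computable n K ->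
    computable n (fun v => (pad (num_length (P v)) (K v)).1).
  by move=> cK; apply: computable_div.
have cPad2 K : computable n K ->
    computable n (fun v => (pad (num_length (P v)) (K v)).2).
  move=> cK; have cM := computable_mod cK cL6.
  apply: computable_mul => //; apply: computable_leq; first exact: computable_succ.
  exact/cRow/cPad1.
exact: computable_grid_adj cP (cPad1 _ cI) (cPad2 _ cI) (cPad1 _ cJ) (cPad2 _ cJ).
Qed.

End ComputableGrid.

Lemma computable_code_matrix n P :
  computable n P -> computable n (fun v => code_matrix (P v)).
Proof.
move=> cP; have cN := computable_code_size cP.
apply: (computable_sum (F := fun i v => \sum_(j < code_size (P v))
  code_adj (P v) i j * 2 ^ (i * code_size (P v) + j)) cN).
have [cP1 cN1] := (computable_behead cP, computable_behead cN).
apply: (computable_sum (F := fun j v => code_adj (P (behead v)) (head 0 v) j *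
   2 ^ (head 0 v * code_size (P (behead v)) + j)) cN1).
have [cP2 cN2] := (computable_behead cP1, computable_behead cN1).
have cJ := computable_head n.+1; have cI := computable_behead (computable_head n).
apply: computable_mul; first exact: computable_code_adj cP2 cI cJ.
exact/computable_exp2/computable_add/cJ/computable_mul.
Qed.

Theorem proposition2 (L : seq bool -> Prop) :
  ~ decidable_language L ->
  ~ decidable_graph_problem (full_colourable (language_family L)).
Proof.
move=> undecL [f fP]; apply: undecL.
have cP := computable_nth (ltn0Sn 0).
have [fN fNP] := computable_code_size cP.
have [fM fMP] := computable_code_matrix cP.
exists (RComp f (fun i : 'I_2 => if val i == 0 then fN else fM)) => w.
have [b b_iff fb] := fP (padded_word_graph w); exists b.
  by rewrite b_iff full_colourable_padded full_colourable_word_graph.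
exists (graph_code (padded_word_graph w)) => //; rewrite graph_code_padded.
by case=> -[|[|//]] lti; [apply: fNP | apply: fMP].
Qed.
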